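(* Let $(a_n)_{n \ge 1}$ be a sequence of positive real numbers and, for $n \ge 2$, let $$u_n = \frac{\sqrt[n-1]{a_{n-1}}\,\sqrt[n+1]{a_{n+1}}}{\left(\sqrt[n]{a_n}\right)^{2}}.$$ Let $N \ge 2$ be an integer and let $\widetilde{f_n}$, $\widetilde{g_n}$ be rational functions of $n$ with $\widetilde{f_n} < u_n < \widetilde{g_n}$ for all $n \ge N$. Put $$p_{n} = \frac{n}{n+1} \widetilde{f_n},\qquad q_{n} = \frac{n}{n+1} \widetilde{g_n}.$$ If for all $n \ge N$, $$t(p_{n},p_{n+1}) > 0,\ t(p_{n},q_{n+1}) > 0,\ t(q_{n},p_{n+1}) > 0,\ t(q_{n},q_{n+1}) > 0,$$ where $t(x,y)=4(1-x)(1-y)-(1-xy)^2$, then the sequence $(b_n)_{n\ge N}$ with $b_n = \sqrt[n]{a_n}/n!$ satisfies the higher order Turán inequality.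
   Context: A sequence $(c_n)_{n \ge m}$ of real numbers satisfies the higher order Turán inequality if for all $n \ge m+1$, $$4(c_{n}^2 - c_{n-1}c_{n+1})(c_{n+1}^2 - c_{n}c_{n+2}) - (c_{n}c_{n+1} - c_{n-1}c_{n+2})^2 \ge 0.$$ *)

(* Defs.v *)
From mathcomp Require Import all_boot all_order all_algebra.
From mathcomp Require Import reals exp.

Set Implicit Arguments.
Unset Strict Implicit.
Unset Printing Implicit Defensive.

Import Order.TTheory GRing.Theory Num.Theory.

Local Open Scope ring_scope.

(* A sequence (c_n)_{n >= m} is a function on nat together with its starting
   index m; the values of the function below m play no role.  In the next
   definition n >= m + 1, so that n.-1 is the genuine predecessor. *)
Definition higher_order_turan (R : realType) (m : nat) (c : nat -> R) : Prop :=
  forall n : nat, (m.+1 <= n)%N ->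
    0 <= 4 * (c n ^+ 2 - c n.-1 * c n.+1) * (c n.+1 ^+ 2 - c n * c n.+2)
         - (c n * c n.+1 - c n.-1 * c n.+2) ^+ 2.

(* The nonnegative n-th root of x >= 0, for n >= 1. *)
Definition real_root (R : realType) (n : nat) (x : R) : R := x `^ (n%:R^-1).

(* On the integers n >= N, f is given by a rational function of n without
   poles there. *)
Definition rational_from (R : realType) (N : nat) (f : nat -> R) : Prop :=
  exists P Q : {poly R}, forall n : nat, (N <= n)%N ->
    Q.[n%:R] != 0 /\ f n = P.[n%:R] / Q.[n%:R].

Definition root_ratio (R : realType) (a : nat -> R) (n : nat) : R :=
  real_root n.-1 (a n.-1) * real_root n.+1 (a n.+1) / real_root n (a n) ^+ 2.

Definition turan_t (R : realType) (x y : R) : R :=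
  4 * (1 - x) * (1 - y) - (1 - x * y) ^+ 2.

(* Main.v *)
Require Import Defs.
From mathcomp Require Import all_boot all_order all_algebra.
From mathcomp Require Import reals exp.
From mathcomp Require Import ring.

(* With r_n = c_{n-1} c_{n+1} / c_n^2, the Turán expression of c at n equals
   (c_n c_{n+1})^2 t(r_n, r_{n+1}), and for c_n = a_n^{1/n} / n! one has
   r_n = n/(n+1) u_n, which lies between p_n and q_n.  As t is a concave
   quadratic in each variable separately, its positivity at the four corners of
   [p_n, q_n] x [p_{n+1}, q_{n+1}] propagates to the whole rectangle. *)

Import Order.TTheory GRing.Theory Num.Theory.

Local Open Scope ring_scope.

Lemma turan_tC (R : realType) (x y : R) : turan_t x y = turan_t y x.
Proof. by rewrite /turan_t; ring. Qed.

(** In its first variable [turan_t] is a quadratic with leading coefficient [- y ^+ 2], so at [x] it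
    exceeds its chord over [p], [q] by [y ^+ 2 * ((x - p) * (q - x))]. *)
Lemma turan_t_gt0_between (R : realType) (p q x y : R) :
  p < x < q -> 0 < turan_t p y -> 0 < turan_t q y -> 0 < turan_t x y.
Proof.
move=> /andP[px xq] tp tq.
have qp : 0 < q - p by rewrite subr_gt0 (lt_trans px).
rewrite -(pmulr_rgt0 _ qp).
have -> : (q - p) * turan_t x y = (q - x) * turan_t p y
    + (x - p) * turan_t q y + y ^+ 2 * ((q - p) * ((x - p) * (q - x))).
  by rewrite /turan_t; ring.
apply: ltr_wpDr; last by rewrite addr_gt0 // mulr_gt0 // subr_gt0.
by rewrite mulr_ge0 ?sqr_ge0 // ltW // !mulr_gt0 // subr_gt0.
Qed.

Lemma turan_t_gt0_rectangle (R : realType) (p q p' q' x y : R) :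
    p < x < q -> p' < y < q' ->
    [/\ 0 < turan_t p p', 0 < turan_t p q',
        0 < turan_t q p' & 0 < turan_t q q'] ->
  0 < turan_t x y.
Proof.
move=> xpq ypq [tpp tpq tqp tqq]; rewrite turan_tC.
(* By symmetry, interpolate in [y] first; this leaves the edges [y = p'] and [y = q'], each settled
   by interpolating in [x]. *)
apply: turan_t_gt0_between ypq _ _; rewrite turan_tC.
  exact: turan_t_gt0_between xpq tpp tqp.
exact: turan_t_gt0_between xpq tpq tqq.
Qed.

Lemma turan_expr_turan_t (R : realType) (c0 c1 c2 c3 : R) :
    c1 != 0 -> c2 != 0 ->
  4 * (c1 ^+ 2 - c0 * c2) * (c2 ^+ 2 - c1 * c3) - (c1 * c2 - c0 * c3) ^+ 2 =
  (c1 * c2) ^+ 2 * turan_t (c0 * c2 / c1 ^+ 2) (c1 * c3 / c2 ^+ 2).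
Proof. by move=> c1N0 c2N0; rewrite /turan_t; field; rewrite c1N0 c2N0. Qed.

(** The factor comes from n!^2 / ((n-1)! (n+1)!) = n / (n+1). *)
Lemma root_ratio_fact (R : realType) (a : nat -> R) (n : nat) :
    (0 < n)%N -> 0 < a n ->
  let b := fun m : nat => real_root m (a m) / m`!%:R in
  b n.-1 * b n.+1 / b n ^+ 2 = n%:R / n.+1%:R * root_ratio a n.
Proof.
case: n => // n _ an_gt0 /=; rewrite /root_ratio /=.
have : real_root n.+1 (a n.+1) != 0 by rewrite gt_eqF ?powR_gt0.
move: (real_root _ _) => y yN0.
have : n`!%:R != 0 :> R by rewrite pnatr_eq0 -lt0n fact_gt0.
have : n.+1%:R != 0 :> R by rewrite pnatr_eq0.
have : n.+2%:R != 0 :> R by rewrite pnatr_eq0.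
rewrite !factS !natrM.
(* Once the factorials are unfolded, the identity holds with these three numbers as independent
   nonzero unknowns. *)
move: n.+2%:R n.+1%:R n`!%:R => k l m kN0 lN0 mN0.
by field; rewrite kN0 lN0 mN0 yN0.
Qed.

Theorem theorem2p3 (R : realType) (a : nat -> R)
    (a_gt0 : forall n : nat, (1 <= n)%N -> 0 < a n)
    (N : nat) (N_ge2 : (2 <= N)%N)
    (f g : nat -> R)
    (f_rat : rational_from N f) (g_rat : rational_from N g)
    (fug : forall n : nat, (N <= n)%N -> f n < root_ratio a n < g n)
    (t_gt0 : let p := fun n : nat => n%:R / n.+1%:R * f n in
       let q := fun n : nat => n%:R / n.+1%:R * g n in
       forall n : nat, (N <= n)%N ->
         [/\ 0 < turan_t (p n) (p n.+1), 0 < turan_t (p n) (q n.+1),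
             0 < turan_t (q n) (p n.+1) & 0 < turan_t (q n) (q n.+1)]) :
  higher_order_turan N (fun n : nat => real_root n (a n) / n`!%:R).
Proof.
move=> n Nn; have leNn : (N <= n)%N by apply: ltnW.
have n_gt0 : (0 < n)%N by apply: leq_trans Nn.
set b := fun m : nat => real_root m (a m) / m`!%:R.
have bN0 m : (0 < m)%N -> b m != 0.
  by move=> m_gt0; rewrite gt_eqF // divr_gt0 ?powR_gt0 ?a_gt0 ?ltr0n ?fact_gt0.
have bE m : (0 < m)%N ->
    b m.-1 * b m.+1 / b m ^+ 2 = m%:R / m.+1%:R * root_ratio a m.
  by move=> m_gt0; apply: root_ratio_fact; rewrite ?a_gt0.
have ratio_between m : (N <= m)%N -> m%:R / m.+1%:R * f m <
    m%:R / m.+1%:R * root_ratio a m < m%:R / m.+1%:R * g m.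
  move=> Nm; have m_gt0 : (0 < m)%N by apply: leq_trans Nm; apply: ltnW.
  by rewrite !ltr_pM2l ?fug // divr_gt0 ?ltr0n.
rewrite turan_expr_turan_t ?bN0 // mulr_ge0 ?sqr_ge0 // ltW //.
(* The second ratio starts at [b n], which matches [b n.+1.-1] only up to conversion, hence the
   explicit instance. *)
rewrite bE // (bE n.+1) //.
exact: turan_t_gt0_rectangle (ratio_between _ leNn)
  (ratio_between _ (leqW leNn)) (t_gt0 _ leNn).
Qed.
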